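(* Let $\mathbb{H}=\mathbb{R}$ or $\mathbb{C}$. Let $\tilde f:(0,2]\to\mathbb{R}$ be a strictly convex and decreasing function defined at $t=0$ by the (possibly infinite) value $\lim_{t\to0^+}\tilde f(t)$, and let $f:(0,\sqrt2]\to\mathbb{R}$ be a strictly convex and decreasing function defined at $t=0$ by the (possibly infinite) value $\lim_{t\to0^+}f(t)$. If $N$ and $d$ are such that an equiangular tight frame (ETF) in $\mathcal{S}(d,N)$ exists, then: (i) it is the unique optimal configuration for the problem of minimizing $\sum_{i\ne j}\widetilde K(x_i,x_j)$ over all $X=\{x_i\}_{i=1}^N\in\mathcal{S}(d,N)$, where $\widetilde K(x,y)=\tilde f(2-2|\langle x,y\rangle|^2)$; (ii) it is also the unique optimal configuration for the problem of minimizing $\sum_{i\ne j}K(x_i,x_j)$ over all $X=\{x_i\}_{i=1}^N\in\mathcal{S}(d,N)$, where $K(x,y)=f\left(\sqrt{2-2|\langle x,y\rangle|^2}\right)$. Here an optimal configuration is understood as an equivalence class of configurations under projective equivalence.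
   Context: $\mathcal{S}(d,N)$ is the collection of all $N$-point configurations $X=\{x_i\}_{i=1}^N$ (repetitions allowed) of unit vectors in $\mathbb{H}^d$. A configuration $X\in\mathcal{S}(d,N)$ is a tight frame if $\sum_{i=1}^N x_ix_i^*=\frac{N}{d}I_d$, where $I_d$ is the $d\times d$ identity matrix; it is equiangular if $|\langle x_i,x_j\rangle|$ is the same constant for all $i\ne j$; it is an equiangular tight frame (ETF) if it is both equiangular and tight. Two configurations are projectively equivalent if one is obtained from the other by the following operations: applying a unitary operator (an orthogonal operator if $\mathbb{H}=\mathbb{R}$) to all the vectors, changing the sign of any $x_i$, and permuting $x_1,\dots,x_N$.
   Formalization: As ETFs in S(d,N) may be projectively inequivalent (e.g. complex d=3, N=9), it is proved that the optimal classes are exactly the ETF classes, with a single optimal class when the ETF is unique up to equivalence; over C, a sign change means multiplication by a unimodular scalar. *)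

(* Defs.v *)
From mathcomp Require Import all_boot all_order all_algebra all_fingroup.
From mathcomp Require Import all_classical all_reals all_analysis.
From mathcomp Require Import complex.

Set Implicit Arguments.
Unset Strict Implicit.
Unset Printing Implicit Defensive.

Import Order.TTheory GRing.Theory Num.Theory.
Import numFieldNormedType.Exports.

Local Open Scope classical_set_scope.
Local Open Scope ring_scope.

(* A common interface for the two scalar fields R and C = R[i]; it carries no
   axioms and is only ever used at the two instances below. *)
Record scalars (R : realType) := Scalars {
  scalar :> numFieldType;
  conjs : scalar -> scalar;
  modulus : scalar -> R
}.

Definition real_scalars (R : realType) : scalars R :=
  @Scalars R R (fun x => x) (fun x => `|x|).

Definition complex_scalars (R : realType) : scalars R :=
  @Scalars R R[i] (@conjc R) (@ComplexField.Normc.normc R).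

Section Configurations.
Variables (R : realType) (H : scalars R).

Definition adjoint (m n : nat) (A : 'M[H]_(m, n)) : 'M[H]_(n, m) :=
  (map_mx (@conjs R H) A)^T.

Definition inner (d : nat) (x y : 'cV[H]_d) : H :=
  \sum_(k < d) x k 0 * conjs (y k 0).

(* Unitary for C, orthogonal for R. *)
Definition is_unitary (d : nat) (U : 'M[H]_d) : Prop :=
  adjoint U *m U = 1%:M.

Section Size.
Variables d N : nat.

Definition config := 'I_N -> 'cV[H]_d.

(* The elements of S(d, N). *)
Definition unit_config (X : config) : Prop :=
  forall i, inner (X i) (X i) = 1.

Definition tight (X : config) : Prop :=
  \sum_(i < N) X i *m adjoint (X i) = (N%:R / d%:R)%:M.

Definition equiangular (X : config) : Prop :=
  exists c : R, forall i j, i != j -> modulus (inner (X i) (X j)) = c.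

Definition ETF (X : config) : Prop :=
  [/\ unit_config X, equiangular X & tight X].

(* Unitary operators act linearly, so any succession of the three elementary
   operations has this normal form.  A sign is a scalar of modulus one:
   this means +1 or -1 when the field is R, and a phase when it is C. *)
Definition projectively_equivalent (X Y : config) : Prop :=
  exists (U : 'M[H]_d) (s : {perm 'I_N}) (e : 'I_N -> H),
    [/\ is_unitary U, forall i, modulus (e i) = 1
      & forall i, Y i = e i *: (U *m X (s i))].

Definition projective_class (X : config) : set config :=
  [set Y | projectively_equivalent X Y].

Local Open Scope ereal_scope.

Definition energy (K : 'cV[H]_d -> 'cV[H]_d -> \bar R) (X : config) : \bar R :=
  \sum_(i < N) \sum_(j < N | j != i) K (X i) (X j).

Definition minimizer (E : config -> \bar R) (X : config) : Prop :=
  unit_config X /\ forall Y, unit_config Y -> E X <= E Y.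

(* An optimal configuration, as a projective equivalence class. *)
Definition optimal_class (E : config -> \bar R) (C : set config) : Prop :=
  (exists2 X, unit_config X & C = projective_class X) /\
  C `<=` minimizer E.

Definition ETF_class (C : set config) : Prop :=
  exists2 X, ETF X & C = projective_class X.

End Size.

End Configurations.

Definition strictly_convex_on (R : realType) (D : set R) (f : R -> R) : Prop :=
  forall (x y t : R), D x -> D y -> x != y -> 0 < t < 1 ->
    f (t * x + (1 - t) * y) < t * f x + (1 - t) * f y.

(* f on the positive reals, given its possibly infinite right limit at 0. *)
Definition extend0 (R : realType) (f : R -> R) (t : R) : \bar R :=
  if t == 0 then lim ((f x)%:E @[x --> (0 : R)^'+]) else (f t)%:E.

Definition kernel_sq (R : realType) (H : scalars R) (d : nat) (f : R -> R)
    (x y : 'cV[H]_d) : \bar R :=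
  extend0 f (2 - 2 * modulus (inner x y) ^+ 2).

Definition kernel_dist (R : realType) (H : scalars R) (d : nat) (f : R -> R)
    (x y : 'cV[H]_d) : \bar R :=
  extend0 f (Num.sqrt (2 - 2 * modulus (inner x y) ^+ 2)).

(* The optimal classes are exactly the classes of equiangular tight frames.
   Some S(d, N) contain projectively inequivalent equiangular tight frames, all
   of which are then optimal, so a single optimal class is asserted precisely
   when the equiangular tight frame itself is unique up to equivalence. *)
Definition ETF_is_unique_optimum (R : realType) (H : scalars R) (d N : nat)
    (E : config H d N -> \bar R) : Prop :=
  (forall C : set (config H d N), optimal_class E C <-> ETF_class C) /\
  (forall X : config H d N, ETF X ->
     (forall Y : config H d N, ETF Y -> projectively_equivalent X Y) ->
     forall C : set (config H d N),
       optimal_class E C <-> C = projective_class X).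

(* Main.v *)
Require Import Defs.
From mathcomp Require Import all_boot all_order all_algebra all_fingroup.
From mathcomp Require Import all_classical all_reals all_analysis.
From mathcomp Require Import complex ring lra.

Set Implicit Arguments.
Unset Strict Implicit.
Unset Printing Implicit Defensive.

Import Order.TTheory GRing.Theory Num.Theory.
Import numFieldNormedType.Exports.

Local Open Scope classical_set_scope.
Local Open Scope ring_scope.

(** For a configuration [X] of unit vectors put
    [t_ij = 2 - 2 |<x_i, x_j>|^2].  Both energies have the form
    [\sum_(i != j) G (t_ij)], where [G] is strictly convex and nonincreasing on
    [0, 2]: for the second kernel [G] is [f] composed with the square root, and
    it inherits strict convexity because the square root is concave and [f] is
    nonincreasing.

    Two facts decide the problem.  First, expanding the squared Hilbert-Schmidt
    norm of [\sum_i x_i x_i^* - N/d] gives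
    [\sum_(i, j) |<x_i, x_j>|^2 = N^2/d + ||\sum_i x_i x_i^* - N/d||^2]
    ([frame_potentialE]).  So the sum of the [t_ij] is bounded above, and the
    bound is attained exactly by the tight frames.  Second, let [t0] be the
    common value of the [t_ij] for an equiangular tight frame.  A line of
    nonpositive slope supports [G] at [t0] and touches it nowhere else
    ([strict_support_line]); summing it over all pairs shows that the energy is
    at least [N (N - 1) G(t0)], the energy of the equiangular tight frame, with
    equality only if every [t_ij] equals [t0] ([convex_potential_sum]).  A
    configuration attaining equality is then equiangular, and its sum of the
    [t_ij] is extremal, so it is tight.  Hence the minimizers are exactly the
    equiangular tight frames ([minimizer_ETF]).

    The passage to projective classes only needs that tightness, by the first
    fact, is a property of the numbers [|<x_i, x_j>|], which projective
    equivalence preserves up to a permutation ([ETF_equivalent]).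

    If [d = 1] and [N >= 2] then [t0 = 0], where [G] may be infinite and has no
    supporting line.  There the bound on the sum of the nonnegative [t_ij]
    already forces all of them to vanish. *)

(** * Convex potentials on an interval *)

Section Potentials.
Variable R : realType.
Implicit Types (g : R -> R) (G : R -> \bar R) (b t : R).

Lemma strictly_convex_chord b g (a c e : R) :
  strictly_convex_on [set` `]0, b]] g -> 0 < a -> a < c -> c < e -> e <= b ->
  g c * (e - a) < (e - c) * g a + (c - a) * g e.
Proof.
move=> gconv a0 ac ce eb.
have ea : 0 < e - a by lra.
pose l := (e - c) / (e - a).
have lE : l * (e - a) = e - c by rewrite /l divfK ?gt_eqF.
have l01 : 0 < l < 1.
  apply/andP; split; first by rewrite /l divr_gt0 // subr_gt0.
  by rewrite /l ltr_pdivrMr // mul1r; lra.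
have cE : c = l * a + (1 - l) * e by lra.
have : g (l * a + (1 - l) * e) < l * g a + (1 - l) * g e.
  apply: gconv => //=; last by rewrite lt_eqF // (lt_trans ac).
  - by rewrite in_itv /= a0 /=; lra.
  - by rewrite in_itv /= eb andbT; lra.
rewrite -cE -(ltr_pM2r ea) => /lt_le_trans; apply.
suff -> : (l * g a + (1 - l) * g e) * (e - a) =
  (l * (e - a)) * g a + ((e - a) - l * (e - a)) * g e by rewrite lE; lra.
ring.
Qed.

Lemma strictly_convex_midpoint b g (s t : R) :
  strictly_convex_on [set` `]0, b]] g -> s \in `]0, b] -> t \in `]0, b] ->
  s != t -> 2 * g ((s + t) / 2) < g s + g t.
Proof.
move=> gconv sb tb st.
have h : 0 < (2^-1 : R) < 1 by lra.
have := gconv s t 2^-1 sb tb st h.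
have -> : 2^-1 * s + (1 - 2^-1) * t = (s + t) / 2 by lra.
lra.
Qed.

(** The slope is the supremum of the slopes of the chords that end at [t0], that
    is, the left derivative of [g] at [t0], which exists also when [t0 = b].
    Strictness off [t0] comes from the strict midpoint inequality.  The last
    clause is strictness at the endpoint [0]: any [V] bounding [g] from above,
    such as its right limit, still lies strictly above the line. *)
Lemma strict_support_line b g (t0 : R) :
  strictly_convex_on [set` `]0, b]] g -> {in `]0, b] &, nonincreasing_fun g} ->
  t0 \in `]0, b] ->
  exists m, [/\ m <= 0,
    forall t, t \in `]0, b] -> t != t0 -> g t0 + m * (t - t0) < g t &
    forall V, (forall t, t \in `]0, b] -> g t <= V) -> g t0 - m * t0 < V].
Proof.
move=> gconv gdecr t0b; have := t0b; rewrite in_itv /= => /andP[t0_gt0 t0_leb].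
pose E := [set (g t0 - g s) / (t0 - s) | s in [set` `]0, t0[ ]].
have Eub0 : ubound E 0.
  move=> _ [s /= /[!in_itv]/= /andP[s0 st0] <-].
  rewrite ler_pdivrMr ?subr_gt0 // mul0r subr_le0.
  by apply: gdecr; rewrite ?in_itv /= ?(ltW st0) //; lra.
have E0 : E !=set0.
  exists ((g t0 - g (t0 / 2)) / (t0 - t0 / 2)); exists (t0 / 2) => //=.
  by rewrite in_itv /=; lra.
have Esup : has_sup E by split => //; exists 0.
pose m := sup E.
have slope_le s : 0 < s -> s < t0 -> g t0 - g s <= m * (t0 - s).
  move=> s0 st0; rewrite -ler_pdivrMr ?subr_gt0 //.
  apply: (sup_upper_bound Esup); exists s => //=.
  by rewrite in_itv /= s0.
have m_le0 : m <= 0 by apply: ge_sup.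
have le_slope t : t0 < t -> t <= b -> m * (t - t0) <= g t - g t0.
  move=> t0t tb; rewrite -ler_pdivlMr ?subr_gt0 //.
  apply: ge_sup => // _ [s /= /[!in_itv]/= /andP[s0 st0] <-].
  rewrite ler_pdivrMr ?subr_gt0 // mulrAC ler_pdivlMr ?subr_gt0 //.
  have := strictly_convex_chord gconv s0 st0 t0t tb; lra.
have below t : t \in `]0, b] -> t != t0 -> g t0 + m * (t - t0) < g t.
  move=> tb tt0; have := strictly_convex_midpoint gconv tb t0b tt0.
  move: tb; rewrite in_itv /= => /andP[t_gt0 t_leb].
  have /orP[lt_tt0|lt_t0t] : (t < t0) || (t0 < t) by rewrite -neq_lt.
    have := @slope_le ((t + t0) / 2); move=> /(_ ltac:(lra) ltac:(lra)); lra.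
  have := @le_slope ((t + t0) / 2); move=> /(_ ltac:(lra) ltac:(lra)); lra.
exists m; split => // V gV.
have hs : t0 / 2 \in `]0, b] by rewrite in_itv /=; lra.
(* [delta] is the excess of [g] over the line at [t0 / 2].  By convexity the
   excess at every smaller point is larger; [t] below is chosen so small that
   the line varies by less than [delta] between [0] and [t]. *)
pose delta := g (t0 / 2) - g t0 + m * t0 / 2.
have delta_gt0 : 0 < delta.
  by have := below _ hs ltac:(rewrite lt_eqF //; lra); rewrite /delta; lra.
have mt0 : 0 <= - (m * t0) by rewrite oppr_ge0 mulr_le0_ge0 // ltW.
have D_gt0 : 0 < 3 * delta - m * t0 by lra.
pose t := delta * t0 / (3 * delta - m * t0).
have tE : t * (3 * delta - m * t0) = delta * t0 by rewrite /t divfK ?gt_eqF.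
have t_gt0 : 0 < t by rewrite /t divr_gt0 // mulr_gt0.
have t_lt : t < t0 / 2.
  rewrite /t ltr_pdivrMr //.
  have := mulr_ge0 mt0 (ltW t0_gt0); have := mulr_gt0 delta_gt0 t0_gt0; lra.
have tV : g t <= V by apply: gV; rewrite in_itv /=; lra.
have := strictly_convex_chord gconv t_gt0 t_lt (_ : t0 / 2 < t0) t0_leb.
move=> /(_ ltac:(lra)) chord.
rewrite -(ltr_pM2l t0_gt0).
apply: lt_le_trans (_ : t0 * g t <= _); last by rewrite ler_pM2l.
have ghE : g (t0 / 2) = delta + g t0 - m * t0 / 2 by rewrite /delta; lra.
move: chord; rewrite ghE.
have := mulr_gt0 delta_gt0 t_gt0; have := mulr_ge0 mt0 (ltW t_gt0).
move: tE; move: delta_gt0 (delta) => _ D; clear; nra.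
Qed.

(** [G] takes the values of [g] off [0]; its value at [0], possibly infinite, is
    that of a right limit in so far as it dominates all values of [g]. *)
Definition convex_potential b g G : Prop :=
  [/\ strictly_convex_on [set` `]0, b]] g,
      {in `]0, b] &, nonincreasing_fun g},
      forall t, t \in `]0, b] -> G t = (g t)%:E &
      forall t, t \in `]0, b] -> ((g t)%:E <= G 0%R)%E].

(** A Jensen inequality for extended-real potentials.  Since the supporting line
    has nonpositive slope, a bound on the sum of the [t i] replaces the equality
    of means. *)
Lemma convex_potential_sum b g G (I : finType) (P : pred I) (t : I -> R) t0 :
  convex_potential b g G -> 0 <= t0 <= b -> (forall i, P i -> 0 <= t i <= b) ->
  \sum_(i | P i) t i <= \sum_(i | P i) t0 ->
  (\sum_(i | P i) G t0 <= \sum_(i | P i) G (t i))%E /\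
  ((\sum_(i | P i) G (t i) <= \sum_(i | P i) G t0)%E ->
     forall i, P i -> t i = t0).
Proof.
move=> [gconv gdecr GE G0] /andP[t0_ge0 t0_le] tP le_sum.
have [t00|t0_neq0] := eqVneq t0 0.
  have ti0 i : P i -> t i = t0.
    rewrite t00; apply: psumr_eq0P => [j /tP/andP[]//|].
    apply/le_anti/andP; split; last by apply: sumr_ge0 => j /tP/andP[].
    by rewrite (le_trans le_sum) // t00 sumr_const mul0rn.
  by split=> //; rewrite le_eqVlt; apply/orP; left; apply/eqP/eq_bigr => i /ti0 ->.
have t0b : t0 \in `]0, b] by rewrite in_itv /= lt_def t0_neq0 t0_ge0.
have [m [m_le0 below below0]] := strict_support_line gconv gdecr t0b.
pose l s := g t0 + m * (s - t0).
have lt_lG s : 0 <= s <= b -> s != t0 -> ((l s)%:E < G s)%E.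
  move=> /andP[s_ge0 sb] st0; have [->|s0] := eqVneq s 0.
    rewrite /l sub0r mulrN; case: (G 0) G0 => [v||] G0; last 2 first.
    - exact: ltry.
    - by have := G0 _ t0b.
    by rewrite lte_fin; apply: below0 => u /G0.
  have sb' : s \in `]0, b] by rewrite in_itv /= lt_def s0 s_ge0.
  by rewrite GE // lte_fin below.
have le_lG s : 0 <= s <= b -> ((l s)%:E <= G s)%E.
  have [->|st0 /lt_lG/(_ st0)/ltW//] := eqVneq s t0.
  by rewrite GE // /l subrr mulr0 addr0.
have sum_l : (\sum_(i | P i) G t0 <= \sum_(i | P i) (l (t i))%:E)%E.
  rewrite (eq_bigr (fun=> (g t0)%:E)); last by move=> *; rewrite GE.
  rewrite !sumEFin lee_fin /l big_split /= lerDl -mulr_sumr sumrB.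
  by rewrite mulr_le0 // subr_le0.
split=> [|le_G i Pi].
  by apply: le_trans sum_l _; apply: lee_sum => i /tP/le_lG.
apply/eqP/negPn/negP => tit0.
have : (\sum_(i | P i) (l (t i))%:E < \sum_(i | P i) G (t i))%E.
  rewrite (bigD1 i) //= [X in (_ < X)%E](bigD1 i) //=.
  apply: lte_leD; first by rewrite sumEFin.
    exact: lt_lG (tP _ Pi) tit0.
  by apply: lee_sum => j /andP[/tP/le_lG].
by rewrite ltNge (le_trans le_G).
Qed.

(** The right limit at [0] of a nonincreasing function is its supremum. *)
Lemma le_extend0 b g t : {in `]0, b] &, nonincreasing_fun g} ->
  t \in `]0, b] -> ((g t)%:E <= extend0 g 0%R)%E.
Proof.
move=> gdecr tb; rewrite /extend0 eqxx.
have := tb; rewrite in_itv /= => /andP[t_gt0 t_le].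
have b0 : 0 < b by apply: lt_le_trans t_le.
have cv := @nonincreasing_at_right_cvge R (EFin \o g) 0 (BRight b).
rewrite (cvg_lim _ (cv _ _)) //=.
by apply: ereal_sup_ubound; exists t.
Qed.

Lemma extend0_potential b g :
  strictly_convex_on [set` `]0, b]] g -> {in `]0, b] &, nonincreasing_fun g} ->
  convex_potential b g (extend0 g).
Proof.
move=> gconv gdecr; split => // t tb; last exact: le_extend0 tb.
by move: tb; rewrite in_itv /extend0 => /andP[/gt_eqF->].
Qed.

Lemma sqrt_concave (x y l : R) : 0 <= x -> 0 <= y -> 0 <= l <= 1 ->
  l * Num.sqrt x + (1 - l) * Num.sqrt y <= Num.sqrt (l * x + (1 - l) * y).
Proof.
move=> x0 y0 /andP[l0 l1].
have l1' : 0 <= 1 - l by rewrite subr_ge0.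
have sx := sqrtr_ge0 x; have sy := sqrtr_ge0 y.
have L0 : 0 <= l * Num.sqrt x + (1 - l) * Num.sqrt y.
  by rewrite addr_ge0 // mulr_ge0.
rewrite -(ger0_norm L0) -sqrtr_sqr; apply: ler_wsqrtr.
(* Both sides are nonnegative; the difference of their squares is
   [l (1 - l) (sqrt x - sqrt y)^2]. *)
rewrite -{2}(sqr_sqrtr x0) -{2}(sqr_sqrtr y0) -subr_ge0.
suff -> : forall u v : R, l * u ^+ 2 + (1 - l) * v ^+ 2 - (l * u + (1 - l) * v) ^+ 2
   = l * (1 - l) * (u - v) ^+ 2 by rewrite mulr_ge0 ?sqr_ge0 // mulr_ge0.
by move=> u v; ring.
Qed.

Lemma itv_convex b (x y l : R) : x \in `]0, b] -> y \in `]0, b] ->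
  0 < l < 1 -> l * x + (1 - l) * y \in `]0, b].
Proof.
rewrite !in_itv /= => /andP[x0 xb] /andP[y0 yb] /andP[l0 l1].
have l1' : 0 < 1 - l by rewrite subr_gt0.
rewrite addr_gt0 ?mulr_gt0 //=.
have -> : b = l * b + (1 - l) * b by ring.
by rewrite lerD // ler_pM2l.
Qed.

Lemma extend0_sqrt_potential b g : 0 <= b ->
  strictly_convex_on [set` `]0, Num.sqrt b]] g ->
  {in `]0, Num.sqrt b] &, nonincreasing_fun g} ->
  convex_potential b (g \o Num.sqrt) (extend0 g \o Num.sqrt).
Proof.
move=> b0 gconv gdecr.
have sqrt_itv t : t \in `]0, b] -> Num.sqrt t \in `]0, Num.sqrt b].
  by rewrite !in_itv /= sqrtr_gt0 => /andP[-> /ler_wsqrtr->].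
have pos t : t \in `]0, b] -> 0 < t by rewrite in_itv => /andP[].
split=> [x y l xb yb xy l01 | x y xb yb xy | t tb | t tb] /=.
- have [x_gt0 y_gt0] := (pos _ xb, pos _ yb).
  have /andP[l_gt0 l_lt1] := l01.
  have [xs ys] := (sqrt_itv _ xb, sqrt_itv _ yb).
  have sxy : Num.sqrt x != Num.sqrt y.
    by apply: contra_neq xy => /eqP; rewrite eqr_sqrt ?ltW // => /eqP.
  apply: le_lt_trans (gconv _ _ _ xs ys sxy l01).
  apply: gdecr; last by apply: sqrt_concave; rewrite ?ltW.
    exact: itv_convex.
  exact/sqrt_itv/itv_convex.
- by apply: gdecr; [exact: sqrt_itv.. | exact: ler_wsqrtr].
- have [_ _ extendE _] := extend0_potential gconv gdecr.
  by rewrite extendE ?sqrt_itv.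
- by rewrite sqrtr0 (le_extend0 gdecr) ?sqrt_itv.
Qed.

End Potentials.

(** * Scalars with a conjugation *)

Section Frames.
Variable R : realType.

(** The properties shared by [R] and [R[i]] on which the whole argument rests: an
    involutive field automorphism and a real-valued modulus with
    [x x^* = |x|^2]. *)
Record star_scalars (H : scalars R) := StarScalars {
  star : {rmorphism H -> H};
  of_real : {rmorphism R -> H};
  starE : forall x : H, conjs x = star x;
  starK : involutive star;
  modulus_ge0 : forall x : H, 0 <= modulus x;
  mul_star : forall x : H, x * star x = of_real (modulus x ^+ 2)
}.

Definition real_star : star_scalars (real_scalars R).
Proof.
refine (@StarScalars (real_scalars R) idfun idfun _ _ _ _) => //= x.
by rewrite -normrX -expr2 ger0_norm ?sqr_ge0.
Defined.

Definition complex_star : star_scalars (complex_scalars R).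
Proof.
refine (@StarScalars (complex_scalars R) (@conjc R) (real_complex R) _ _ _ _).
- by [].
- exact: conjcK.
- by case=> a b; exact: sqrtr_ge0.
- move=> x; rewrite -sqr_normc /= rmorphXn; congr (_ ^+ 2).
Defined.

Variables (H : scalars R) (S : star_scalars H).
Local Notation "x ^*" := (star S x) : ring_scope.
Local Notation "r %:H" := (of_real S r) (at level 2, format "r %:H").
Local Notation mod2 x := (modulus x ^+ 2).

Lemma modulusM (x y : H) : modulus (x * y) = modulus x * modulus y.
Proof.
have M0 := modulus_ge0 S.
apply/eqP; rewrite -(@eqrXn2 _ 2) ?mulr_ge0 // exprMn; apply/eqP.
apply: (fmorph_inj (of_real S)).
by rewrite [RHS]rmorphM /= -!mul_star rmorphM /=; ring.
Qed.

Lemma modulus1 : modulus (1 : H) = 1.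
Proof.
apply/eqP; rewrite -(@eqrXn2 _ 2) ?(modulus_ge0 S) // expr1n; apply/eqP.
by apply: (fmorph_inj (of_real S)); rewrite -mul_star !rmorph1 mulr1.
Qed.

Lemma modulus0 : modulus (0 : H) = 0.
Proof.
apply/eqP; rewrite -sqrf_eq0; apply/eqP/(fmorph_inj (of_real S)).
by rewrite -mul_star mul0r rmorph0.
Qed.

Lemma modulus_star (x : H) : modulus x^* = modulus x.
Proof.
apply/eqP; rewrite -(@eqrXn2 _ 2) ?(modulus_ge0 S) //; apply/eqP.
by apply: (fmorph_inj (of_real S)); rewrite -!mul_star (starK S) mulrC.
Qed.

Lemma modulus_eq0 (x : H) : modulus x = 0 -> x = 0.
Proof.
move=> x0; have := mul_star S x; rewrite x0 expr0n rmorph0 => /eqP.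
by rewrite mulf_eq0 fmorph_eq0 orbb => /eqP.
Qed.

(** * Adjoints and the inner product *)

Lemma adjointE m n (A : 'M[H]_(m, n)) : adjoint A = (map_mx (star S) A)^T.
Proof. by apply/matrixP => i j; rewrite !mxE (starE S). Qed.

Lemma adjointM m n p (A : 'M[H]_(m, n)) (B : 'M[H]_(n, p)) :
  adjoint (A *m B) = adjoint B *m adjoint A.
Proof. by rewrite !adjointE map_mxM trmx_mul. Qed.

Lemma adjointK m n : cancel (@adjoint R H m n) (@adjoint R H n m).
Proof. by move=> A; apply/matrixP => i j; rewrite !mxE !(starE S) (starK S). Qed.

Lemma adjoint1 n : adjoint (1%:M : 'M[H]_n) = 1%:M.
Proof. by rewrite adjointE map_mx1 trmx1. Qed.

Lemma innerE d (x y : 'cV[H]_d) : inner x y = (adjoint y *m x) 0 0.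
Proof. by rewrite mxE; apply: eq_bigr => k _; rewrite !mxE mulrC. Qed.

Lemma inner_star d (x y : 'cV[H]_d) : (inner x y)^* = inner y x.
Proof.
by rewrite rmorph_sum; apply: eq_bigr => k _; rewrite !(starE S) rmorphM /= (starK S) mulrC.
Qed.

Lemma innerDl d (x y z : 'cV[H]_d) : inner (x + y) z = inner x z + inner y z.
Proof. by rewrite !innerE mulmxDr mxE. Qed.

Lemma innerZl d a (x y : 'cV[H]_d) : inner (a *: x) y = a * inner x y.
Proof. by rewrite !innerE -scalemxAr mxE. Qed.

Lemma innerDr d (x y z : 'cV[H]_d) : inner z (x + y) = inner z x + inner z y.
Proof. by rewrite -!(inner_star _ z) innerDl rmorphD. Qed.

Lemma innerZr d a (x y : 'cV[H]_d) : inner x (a *: y) = a^* * inner x y.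
Proof. by rewrite -!(inner_star _ x) innerZl rmorphM. Qed.

Lemma inner_unitary d (U : 'M[H]_d) (x y : 'cV[H]_d) :
  Defs.is_unitary U -> inner (U *m x) (U *m y) = inner x y.
Proof.
by move=> UU; rewrite !innerE adjointM mulmxA -(mulmxA _ _ U) UU mulmx1.
Qed.

Lemma inner_self d (x : 'cV[H]_d) :
  inner x x = (\sum_k mod2 (x k 0))%:H.
Proof. by rewrite rmorph_sum; apply: eq_bigr => k _; rewrite (starE S) mul_star. Qed.

(** The vector [x - <x, y> y] has squared norm [1 - |<x, y>|^2]. *)
Lemma cauchy_schwarz_unit d (x y : 'cV[H]_d) :
  inner x x = 1 -> inner y y = 1 -> modulus (inner x y) <= 1.
Proof.
move=> xx yy; set a := inner x y.
have := inner_self (x + (- a) *: y).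
rewrite !(innerDl, innerDr, innerZl, innerZr) xx yy -/a -(inner_star x y) -/a.
rewrite rmorphN; have -> : 1 + - a^* * a + (- a * a^* + - a * (- a^* * 1))
  = (1 - mod2 a)%:H by rewrite rmorphB rmorph1 -mul_star; ring.
move/(fmorph_inj (of_real S)) => aE.
have : 0 <= 1 - mod2 a by rewrite aE; apply: sumr_ge0 => k _; exact: sqr_ge0.
by rewrite subr_ge0 -[X in _ <= X](expr1n _ 2) ler_pXn2r ?nnegrE ?(modulus_ge0 S).
Qed.

(** * Frame potential *)

(** The square of the Hilbert-Schmidt norm. *)
Definition frob m n (A : 'M[H]_(m, n)) : R := \sum_i \sum_j mod2 (A i j).

Lemma frob_ge0 m n (A : 'M[H]_(m, n)) : 0 <= frob A.
Proof. by apply: sumr_ge0 => i _; apply: sumr_ge0 => j _; apply: sqr_ge0. Qed.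

Lemma frob_eq0 m n (A : 'M[H]_(m, n)) : frob A = 0 <-> A = 0.
Proof.
split=> [A0|->].
  apply/matrixP => i j; rewrite mxE; apply: modulus_eq0; apply/eqP.
  rewrite -sqrf_eq0; apply/eqP.
  have /psumr_eq0P/(_ i isT)/psumr_eq0P/(_ j isT) := A0.
  by apply => *; rewrite ?sqr_ge0 //; apply: sumr_ge0 => *; apply: sqr_ge0.
by rewrite /frob big1 // => i _; rewrite big1 // => j _; rewrite mxE modulus0 expr0n.
Qed.

Lemma mxtrace_adjoint m n (A : 'M[H]_(m, n)) : \tr (A *m adjoint A) = (frob A)%:H.
Proof.
rewrite /mxtrace rmorph_sum; apply: eq_bigr => i _; rewrite mxE rmorph_sum.
by apply: eq_bigr => j _; rewrite !mxE (starE S) mul_star.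
Qed.

Definition frame_operator d N (X : config H d N) : 'M[H]_d :=
  \sum_(i < N) X i *m adjoint (X i).

Definition frame_potential d N (X : config H d N) : R :=
  \sum_(i < N) \sum_(j < N) mod2 (inner (X i) (X j)).

Lemma mxtrace_rank1 d (x y : 'cV[H]_d) : \tr (x *m adjoint y) = inner x y.
Proof. by rewrite mxtrace_mulC /mxtrace big_ord_recl big_ord0 addr0 innerE. Qed.

Lemma mxtrace_frame_operator2 d N (X : config H d N) :
  \tr (frame_operator X *m frame_operator X) = (frame_potential X)%:H.
Proof.
rewrite /frame_operator mulmx_suml raddf_sum rmorph_sum; apply: eq_bigr => i _.
rewrite mulmx_sumr raddf_sum rmorph_sum; apply: eq_bigr => j _.
rewrite mulmxA -(mulmxA (X i)) (mx11_scalar (adjoint (X i) *m X j)) -innerE.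
rewrite mul_mx_scalar -scalemxAl /= mxtraceZ mxtrace_rank1.
by rewrite -mul_star inner_star mulrC.
Qed.

(** The trace of the square of the self-adjoint matrix [F - N/d], with [F] the
    frame operator, expands into [\tr (F^2) - 2 (N/d) \tr F + N^2/d]; here
    [\tr F = N] because the vectors are unit.  The identity also holds for
    [d = 0], where the quotients by [d] are [0]. *)
Lemma frame_potentialE d N (X : config H d N) : unit_config X ->
  frame_potential X =
    N%:R ^+ 2 / d%:R + frob (frame_operator X - (N%:R / d%:R)%:M).
Proof.
move=> Xunit; apply: (fmorph_inj (of_real S)).
set a : H := N%:R / d%:R.
have aE : a^* = a by rewrite /a fmorph_div !rmorph_nat.
have SE : adjoint (frame_operator X - a%:M) = frame_operator X - a%:M.
  rewrite adjointE map_mxB map_scalar_mx aE linearB /= tr_scalar_mx; congr (_ - _).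
  rewrite -adjointE /frame_operator adjointE raddf_sum /= raddf_sum /=.
  by apply: eq_bigr => i _; rewrite -adjointE adjointM adjointK.
have trS : \tr (frame_operator X) = N%:R.
  rewrite raddf_sum /= (eq_bigr (fun=> 1)) ?sumr_const ?card_ord // => i _.
  by rewrite mxtrace_rank1.
rewrite rmorphD /= -mxtrace_adjoint SE mulmxBl !mulmxBr.
rewrite mul_mx_scalar !mul_scalar_mx !raddfB /= !mxtraceZ.
rewrite mxtrace_frame_operator2 trS mxtrace_scalar.
rewrite fmorph_div rmorphXn !rmorph_nat /a.
have [->|d0] := eqVneq (d%:R : H) 0.
  rewrite invr0 !mulr0 !mul0r; ring.
by rewrite -mulr_natr; field.
Qed.

Lemma tight_frame_potential d N (X : config H d N) : unit_config X ->
  tight X <-> frame_potential X = N%:R ^+ 2 / d%:R.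
Proof.
move=> Xunit; rewrite frame_potentialE //.
split=> [XT|/eqP].
  have /frob_eq0-> : frame_operator X - (N%:R / d%:R)%:M = 0.
    by rewrite /frame_operator XT subrr.
  by rewrite addr0.
by rewrite -subr_eq0 addrAC subrr add0r => /eqP/frob_eq0/eqP; rewrite subr_eq0 => /eqP.
Qed.

Lemma welch_bound d N (X : config H d N) : unit_config X ->
  N%:R ^+ 2 / d%:R <= frame_potential X.
Proof. by move=> /frame_potentialE->; rewrite lerDl frob_ge0. Qed.

(** * Projective equivalence *)

Lemma modulus_inner_equivalent d N (X Y : config H d N) U s e :
  Defs.is_unitary U -> (forall i, modulus (e i) = 1) ->
  (forall i, Y i = e i *: (U *m X (s i))) ->
  forall i j : 'I_N, modulus (inner (Y i) (Y j)) = modulus (inner (X (s i)) (X (s j))).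
Proof.
move=> UU e1 YE i j; rewrite !YE innerZl innerZr inner_unitary //.
by rewrite !modulusM modulus_star !e1 !mul1r.
Qed.

Lemma projectively_equivalent_refl d N (X : config H d N) :
  projectively_equivalent X X.
Proof.
exists 1%:M, 1%g, (fun=> 1); split=> [|i|i].
- by rewrite /Defs.is_unitary adjoint1 mulmx1.
- exact: modulus1.
- by rewrite perm1 mul1mx scale1r.
Qed.

Lemma projectively_equivalent_sym d N (X Y : config H d N) :
  projectively_equivalent X Y -> projectively_equivalent Y X.
Proof.
case=> U [s [e [UU e1 YE]]].
have e0 i : e i != 0.
  apply/eqP => ei0; have := e1 i.
  by rewrite ei0 modulus0 => /eqP; rewrite eq_sym oner_eq0.
exists (adjoint U), s^-1%g, (fun i => (e (s^-1%g i))^-1); split=> [|i|i].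
- by rewrite /Defs.is_unitary adjointK; apply: mulmx1C.
- apply: (mulfI (oner_neq0 R)); rewrite -{1}(e1 (s^-1%g i)) -modulusM divff //.
  by rewrite modulus1 mulr1.
- rewrite YE -scalemxAr scalerA mulVf // scale1r mulmxA UU mul1mx.
  by rewrite permKV.
Qed.

Lemma projectively_equivalent_trans d N (X Y Z : config H d N) :
  projectively_equivalent X Y -> projectively_equivalent Y Z ->
  projectively_equivalent X Z.
Proof.
case=> U [s [e [UU e1 YE]]] [V [r [f [VV f1 ZE]]]].
exists (V *m U), (r * s)%g, (fun i => f i * e (r i)); split=> [|i|i].
- rewrite /Defs.is_unitary adjointM mulmxA -(mulmxA (adjoint U)) VV mulmx1; exact: UU.
- by rewrite modulusM f1 e1 mulr1.
- by rewrite ZE YE -scalemxAr scalerA mulmxA permM.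
Qed.

Lemma projective_class_eq d N (X Y : config H d N) :
  projectively_equivalent X Y -> projective_class X = projective_class Y.
Proof.
move=> XY; apply/seteqP; split=> Z /=.
  exact/projectively_equivalent_trans/projectively_equivalent_sym.
exact: projectively_equivalent_trans.
Qed.

Lemma unit_config_equivalent d N (X Y : config H d N) :
  projectively_equivalent X Y -> unit_config X -> unit_config Y.
Proof.
case=> U [s [e [UU e1 YE]]] Xunit i.
rewrite YE innerZl innerZr inner_unitary // Xunit mulr1 mul_star e1 expr1n.
by rewrite rmorph1.
Qed.

(** Tightness is read off the frame potential, which depends only on the moduli
    of the inner products. *)
Lemma ETF_equivalent d N (X Y : config H d N) :
  projectively_equivalent X Y -> ETF X -> ETF Y.
Proof.
move=> XY [Xunit [c Xc] Xtight].
have Yunit := unit_config_equivalent XY Xunit.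
have [U [s [e [UU e1 YE]]]] := XY.
have YX := modulus_inner_equivalent UU e1 YE.
split=> //.
  by exists c => i j ij; rewrite YX Xc // (inj_eq perm_inj).
apply/(tight_frame_potential Yunit).
rewrite -(proj1 (tight_frame_potential Xunit) Xtight) /frame_potential.
rewrite [RHS](reindex_inj (@perm_inj _ s)); apply: eq_bigr => i _.
rewrite [RHS](reindex_inj (@perm_inj _ s)); apply: eq_bigr => j _.
by rewrite YX.
Qed.

(** * Optimality of equiangular tight frames *)

(** The squared projective distance between two vectors of [X]. *)
Definition gap (d N : nat) (X : config H d N) (i j : 'I_N) : R :=
  2 - 2 * mod2 (inner (X i) (X j)).

Lemma gap_itv d N (X : config H d N) i j : unit_config X -> 0 <= gap X i j <= 2.
Proof.
move=> Xunit; rewrite /gap.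
have := modulus_ge0 S (inner (X i) (X j)).
have := cauchy_schwarz_unit (Xunit i) (Xunit j); nra.
Qed.

(** The diagonal may be included in the sum, since its gaps vanish. *)
Lemma sum_gap d N (X : config H d N) : unit_config X ->
  \sum_(p : 'I_N * 'I_N | p.2 != p.1) gap X p.1 p.2 =
  2 * (N%:R ^+ 2 - frame_potential X).
Proof.
move=> Xunit.
have gap0 i : gap X i i = 0.
  suff m1 : modulus (inner (X i) (X i)) = 1 by rewrite /gap m1; ring.
  by rewrite Xunit modulus1.
have -> : \sum_(p : 'I_N * 'I_N | p.2 != p.1) gap X p.1 p.2 =
          \sum_(p : 'I_N * 'I_N) gap X p.1 p.2.
  rewrite [RHS](bigID (fun p : 'I_N * 'I_N => p.2 != p.1)) /= [X in _ = _ + X]big1 ?addr0 //.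
  by case=> i j /= /negPn/eqP ->.
rewrite -(pair_bigA _ (gap X)) /= /frame_potential /gap.
rewrite (eq_bigr (fun i => 2 * (N%:R - \sum_j mod2 (inner (X i) (X j))))).
  by rewrite -mulr_sumr sumrB sumr_const card_ord -[N%:R *+ N]mulr_natr -expr2.
by move=> i _; rewrite sumrB sumr_const card_ord -mulr_sumr mulrBr -[2 *+ N]mulr_natr.
Qed.

Section Minimizers.
Variables (d N : nat) (g : R -> R) (G : R -> \bar R).
Hypothesis Gpot : convex_potential 2 g G.
Local Notation E :=
  (@energy R H d N (fun x y => G (2 - 2 * mod2 (inner x y)))).

Lemma energy_gap (X : config H d N) :
  (E X = \sum_(p : 'I_N * 'I_N | p.2 != p.1) G (gap X p.1 p.2))%E.
Proof. by rewrite /energy pair_big_dep. Qed.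

(** By the Welch bound the gaps of [Y] have a sum at most that of [X], whose
    gaps are all equal, so [convex_potential_sum] applies.  In case of equality
    the gaps of [Y] and [X] agree, hence so do their frame potentials. *)
Lemma ETF_energy_le (X Y : config H d N) : ETF X -> unit_config Y ->
  (E X <= E Y)%E /\ ((E Y <= E X)%E -> ETF Y).
Proof.
move=> [Xunit [c Xc] Xtight] Yunit.
have sum_le : \sum_(p : 'I_N * 'I_N | p.2 != p.1) gap Y p.1 p.2 <=
              \sum_(p : 'I_N * 'I_N | p.2 != p.1) gap X p.1 p.2.
  rewrite !sum_gap // ler_pM2l // lerB // (proj1 (tight_frame_potential Xunit) Xtight).
  exact: welch_bound.
have ETF_Y : (forall i j, j != i -> gap Y i j = gap X i j) -> ETF Y.
  move=> YX; have modYX i j : i != j ->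
      modulus (inner (Y i) (Y j)) = modulus (inner (X i) (X j)).
    rewrite eq_sym => /YX; rewrite /gap => eqYX.
    by apply/eqP; rewrite -(@eqrXn2 _ 2) ?(modulus_ge0 S) //; apply/eqP; lra.
  split=> //; first by exists c => i j ij; rewrite modYX ?Xc.
  apply/(tight_frame_potential Yunit).
  rewrite -(proj1 (tight_frame_potential Xunit) Xtight).
  suff : 2 * (N%:R ^+ 2 - frame_potential Y) = 2 * (N%:R ^+ 2 - frame_potential X) by lra.
  by rewrite -!sum_gap //; apply: eq_bigr => p; exact: YX.
pose t0 : R := 2 - 2 * c ^+ 2.
have gapX p : p.2 != p.1 -> gap X p.1 p.2 = t0.
  by move=> p12; rewrite /gap Xc // eq_sym.
(* Without off-diagonal pairs, [c] is arbitrary and [t0] need not lie in the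
   domain of [G], but then both energies are empty sums. *)
have [[p0 p0_off]|no_pair] := pselect (exists p : 'I_N * 'I_N, p.2 != p.1).
  have t0_itv : 0 <= t0 <= 2 by rewrite -(gapX _ p0_off) gap_itv.
  have sum_t0 : \sum_(p : 'I_N * 'I_N | p.2 != p.1) gap X p.1 p.2 =
                \sum_(p : 'I_N * 'I_N | p.2 != p.1) t0 by exact: eq_bigr.
  rewrite sum_t0 in sum_le.
  have [le_XY eq_YX] := convex_potential_sum Gpot t0_itv
    (fun p _ => gap_itv p.1 p.2 Yunit) sum_le.
  have EX : E X = (\sum_(p : 'I_N * 'I_N | p.2 != p.1) G t0)%E.
    by rewrite energy_gap; apply: eq_bigr => p /gapX ->.
  rewrite EX energy_gap; split=> // /eq_YX gapY.
  by apply: ETF_Y => i j ij; rewrite (gapX (i, j)) // -(gapY (i, j)).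
have no_off (p : 'I_N * 'I_N) : (p.2 != p.1) = false
  by apply/negbTE/negP => p_off; apply: no_pair; exists p.
split=> [|_]; first by rewrite !energy_gap !big_pred0.
by apply: ETF_Y => i j; rewrite (no_off (i, j)).
Qed.

Lemma minimizer_ETF (X0 X : config H d N) : ETF X0 -> minimizer E X <-> ETF X.
Proof.
move=> X0_ETF; split=> [[Xunit Xmin]|XE].
  have [X0unit _ _] := X0_ETF.
  by apply: (ETF_energy_le X0_ETF Xunit).2; apply: Xmin.
by split=> [|Y Yunit]; [case: XE | case: (ETF_energy_le XE Yunit)].
Qed.

Lemma ETF_unique_optimum : (exists X : config H d N, ETF X) -> ETF_is_unique_optimum E.
Proof.
case=> X0 X0_ETF.
have optE C : optimal_class E C <-> ETF_class C.
  split=> [[[X Xunit ->] /(_ X (projectively_equivalent_refl X)) /=]|[X XE ->]].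
    by move=> /(minimizer_ETF _ X0_ETF) XE; exists X.
  split; first by exists X => //; case: XE.
  by move=> Y /= /ETF_equivalent/(_ XE) YE; apply/(minimizer_ETF _ X0_ETF).
split=> // X XE Xuniq C; rewrite optE; split=> [[Y YE ->]|->]; last by exists X.
by apply/esym/projective_class_eq/Xuniq.
Qed.

End Minimizers.

End Frames.

Theorem theorem5p4 (R : realType) (H : scalars R)
  (hH : H = real_scalars R \/ H = complex_scalars R)
  (ft : R -> R)
  (ft_convex : strictly_convex_on [set` `]0, 2]] ft)
  (ft_decr : {in `]0, 2] &, nonincreasing_fun ft})
  (f : R -> R)
  (f_convex : strictly_convex_on [set` `]0, Num.sqrt 2]] f)
  (f_decr : {in `]0, Num.sqrt 2] &, nonincreasing_fun f})
  (d N : nat)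
  (ETF_exists : exists X : config H d N, ETF X) :
  ETF_is_unique_optimum (energy (N := N) (kernel_sq (H := H) (d := d) ft)) /\
  ETF_is_unique_optimum (energy (N := N) (kernel_dist (H := H) (d := d) f)).
Proof.
have [S] : inhabited (star_scalars H).
  by case: hH => ->; split; [exact: real_star | exact: complex_star].
split.
  exact: (ETF_unique_optimum S (extend0_potential ft_convex ft_decr) ETF_exists).
exact: (ETF_unique_optimum S (extend0_sqrt_potential (ler0n _ 2) f_convex f_decr)
  ETF_exists).
Qed.
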